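(* Let $\mathcal{C}$ be the circle in $\mathbb{C}_p$ with center $x_{0}$ and radius $R>0$. Suppose $$f(x) = \sum_{n = -\infty}^{\infty}c_{n}(x - x_{0})^{n}\qquad \text{for } |x - x_{0}|_{p} = R,$$ the Laurent series converging there. Let $b$ be a point on $\mathcal{C}$, let $a$ be such that $|a - b|_{p} = R$ and let $\alpha \in \mathbb{Z}_{\geq 0}$. Then the integral below exists and $$\int_{\mathcal{A}(a,b),\Phi_{\alpha}}f(x)\,dx = \frac{c_{-1}}{1 - \omega\left( \frac{a - x_{0}}{a - b}\right)^{p^{\alpha}}}.$$
   Context: $p$ is an odd prime; $\mathbb{C}_p$ is the completion of an algebraic closure of $\mathbb{Q}_p$, with $|p|_p=1/p$. Arc: for $a\ne b$ in $\mathbb{C}_p$ with $R=|a-b|_p$, the arc $\mathcal{A}(a,b)$ is the open disc $\{x : |x-b|_p<R\}$. Path sequence: a function $\varphi$ defined for all integers $k\ge k_0$ (some $k_0\in\mathbb{Z}^+$), with values in $\mathbb{Z}^+$ and strictly increasing. For $f:\mathcal{A}(a,b)\to\mathbb{C}_p$ put $A_{f,\varphi}(k)=p^{-\varphi(k)}\sum_{\zeta}(x-a)f(x)$, where $x=a+(b-a)\zeta$ and $\zeta$ runs through the $p^{\varphi(k)}$-th roots of unity. A non-empty family $\Phi$ of path sequences is interlocked if for all $\varphi_1,\varphi_2\in\Phi$ there are $\varphi_3\in\Phi$ and $k_0$ such that $\varphi_3(k)$, $k\ge k_0$, is a subsequence of both $\varphi_1$ and $\varphi_2$. For interlocked $\Phi$,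 $\int_{\mathcal{A}(a,b),\Phi}f(x)\,dx=L$ means: for every $\varepsilon>0$ there are $\varphi_\varepsilon\in\Phi$ and $K_\varepsilon$ with $|A_{f,\varphi_\varepsilon}(k)-L|_p<\varepsilon$ for all $k>K_\varepsilon$ (such $L$ is unique if it exists). For $\alpha\in\mathbb{Z}$, $\Phi_\alpha$ is the interlocked family $\{\varphi : \varphi(k)=\alpha+\lambda k,\ \lambda=1,2,\dots\}$. $\omega$ is the Teichmüller character: for $|x|_p=1$, $\omega(x)$ is the unique root of unity of order prime to $p$ with $|x-\omega(x)|_p<1$; $\omega(x)=0$ if $|x|_p<1$. *)

(* Defs.v *)
From HB Require Import structures.
From mathcomp Require Import all_boot all_order all_algebra.
From mathcomp Require Import all_classical all_reals all_analysis.
From mathcomp Require Import zify.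
Set Implicit Arguments.
Unset Strict Implicit.
Unset Printing Implicit Defensive.
Import Order.TTheory GRing.Theory Num.Theory.
Import numFieldNormedType.Exports.
Local Open Scope classical_set_scope.
Local Open Scope ring_scope.

(* Fields with an ultrametric absolute value.  The library's norms take values
   in an ordered base field, so they do not cover a field such as C_p with its
   real-valued absolute value. *)

Record is_ultrametric_abs (R : realType) (K : fieldType) (v : K -> R) : Prop := {
  uabs_ge0 : forall x, 0 <= v x;
  uabs_eq0 : forall x, v x = 0 <-> x = 0;
  uabsM : forall x y, v (x * y) = v x * v y;
  uabsD : forall x y, v (x + y) <= Num.max (v x) (v y) }.

Definition abs_cvg (R : realType) (K : fieldType) (v : K -> R)
    (u : nat -> K) (l : K) : Prop :=
  (fun n => v (u n - l)) @ \oo --> (0 : R).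

Definition abs_cauchy (R : realType) (K : fieldType) (v : K -> R)
    (u : nat -> K) : Prop :=
  forall e : R, 0 < e ->
    exists N : nat, forall m n, (N <= m)%N -> (N <= n)%N -> v (u m - u n) < e.

Record is_completion (R : realType) (K L : fieldType)
    (vK : K -> R) (vL : L -> R) (i : {rmorphism K -> L}) : Prop := {
  compl_abs : is_ultrametric_abs vL;
  compl_isometry : forall x, vL (i x) = vK x;
  compl_dense : forall (y : L) (e : R), 0 < e -> exists x, vL (y - i x) < e;
  compl_complete : forall u, abs_cauchy vL u -> exists l, abs_cvg vL u l }.

(* [logn p 0 = 0], hence the separate case for [0]. *)
Definition padic_abs (R : realType) (p : nat) (q : rat) : R :=
  if q == 0 then 0
  else (p%:R : R) ^+ logn p `|denq q|%N / (p%:R : R) ^+ logn p `|numq q|%N.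

(* A completion of an algebraic closure of a completion of the rationals for
   the p-adic absolute value; such a tower is unique up to isometric
   isomorphism. *)
Record Cp_field (R : realType) (p : nat) := CpField {
  Qp : fieldType;
  absQp : Qp -> R;
  rat_to_Qp : {rmorphism rat -> Qp};
  Qp_completion : is_completion (@padic_abs R p) absQp rat_to_Qp;
  Qpbar : closedFieldType;
  absQpbar : Qpbar -> R;
  Qp_to_Qpbar : {rmorphism Qp -> Qpbar};
  Qpbar_algebraic : forall x : Qpbar, algebraicOver Qp_to_Qpbar x;
  absQpbar_ultrametric : is_ultrametric_abs absQpbar;
  absQpbar_extends : forall x : Qp, absQpbar (Qp_to_Qpbar x) = absQp x;
  Cp :> fieldType;
  absp : Cp -> R;
  Qpbar_to_Cp : {rmorphism Qpbar -> Cp};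
  Cp_completion : is_completion absQpbar absp Qpbar_to_Cp }.

Arguments absp {R p} K x : rename.

Definition circle (R : realType) (p : nat) (K : Cp_field R p)
    (x0 : K) (r : R) : set K :=
  [set x | absp K (x - x0) = r].

Definition arc (R : realType) (p : nat) (K : Cp_field R p) (a b : K) : set K :=
  [set x | absp K (x - b) < absp K (a - b)].

(* Only the values of [path] at arguments [>= start] are meaningful. *)
Record path_seq := PathSeq {
  start : nat;
  path :> nat -> nat;
  start_gt0 : (0 < start)%N;
  path_gt0 : forall k, (start <= k)%N -> (0 < path k)%N;
  path_incr : forall j k, (start <= j)%N -> (j < k)%N -> (path j < path k)%N }.

(* [psi k], [k >= k0], is a subsequence of [phi]. *)
Definition tail_subsequence (psi : path_seq) (k0 : nat) (phi : path_seq) : Prop :=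
  (start psi <= k0)%N /\
  exists j : nat -> nat,
    (forall k, (k0 <= k)%N -> (start phi <= j k)%N /\ psi k = phi (j k)) /\
    (forall k l, (k0 <= k)%N -> (k < l)%N -> (j k < j l)%N).

Record interlocked_family := InterlockedFamily {
  family : set path_seq;
  family_nonempty : family !=set0;
  family_interlocked : forall phi1 phi2, family phi1 -> family phi2 ->
    exists phi3 k0, [/\ family phi3, tail_subsequence phi3 k0 phi1
                      & tail_subsequence phi3 k0 phi2] }.

Definition arith_paths (alpha : int) : set path_seq :=
  [set phi | exists2 lam : nat, (0 < lam)%N &
     forall k, (start phi <= k)%N -> (phi k)%:Z = alpha + (lam * k)%N%:Z].

Definition arith_start (alpha : int) : nat := (absz alpha).+1.

Definition arith_fun (alpha : int) (lam k : nat) : nat :=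
  absz (alpha + (lam * k)%N%:Z).

Lemma arith_funE alpha lam k : (0 < lam)%N -> (arith_start alpha <= k)%N ->
  (arith_fun alpha lam k)%:Z = alpha + (lam * k)%N%:Z /\
  (0 < arith_fun alpha lam k)%N.
Proof.
rewrite /arith_fun /arith_start => l0 hk.
have : (k <= lam * k)%N by apply: leq_pmull.
lia.
Qed.

Lemma arith_path_exists alpha lam : (0 < lam)%N ->
  exists phi : path_seq, start phi = arith_start alpha /\
    path phi = arith_fun alpha lam.
Proof.
move=> l0.
have h0 : (0 < arith_start alpha)%N by [].
have h1 k : (arith_start alpha <= k)%N -> (0 < arith_fun alpha lam k)%N.
  by move=> hk; case: (arith_funE l0 hk).
have h2 j k : (arith_start alpha <= j)%N -> (j < k)%N ->
    (arith_fun alpha lam j < arith_fun alpha lam k)%N.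
  move=> hj hjk.
  have [ej _] := arith_funE l0 hj.
  have [ek _] := arith_funE l0 (leq_trans hj (ltnW hjk)).
  have : (lam * j < lam * k)%N by rewrite ltn_pmul2l.
  lia.
by exists (PathSeq h0 h1 h2).
Qed.

Lemma arith_paths_nonempty alpha : arith_paths alpha !=set0.
Proof.
have [phi [sE pE]] := @arith_path_exists alpha 1%N isT.
exists phi; exists 1%N => // k; rewrite sE pE => hk.
by case: (@arith_funE alpha 1%N k isT hk).
Qed.

Lemma arith_paths_interlocked alpha phi1 phi2 :
  arith_paths alpha phi1 -> arith_paths alpha phi2 ->
  exists phi3 k0, [/\ arith_paths alpha phi3, tail_subsequence phi3 k0 phi1
                    & tail_subsequence phi3 k0 phi2].
Proof.
move=> [l1 l1_gt0 E1] [l2 l2_gt0 E2].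
have l_gt0 : (0 < l1 * l2)%N by rewrite muln_gt0 l1_gt0.
have [phi [sE pE]] := @arith_path_exists alpha (l1 * l2) l_gt0.
have E k : (start phi <= k)%N -> (phi k)%:Z = alpha + (l1 * l2 * k)%N%:Z.
  by rewrite sE pE => hk; case: (arith_funE l_gt0 hk).
have sub l m (psi : path_seq) : (0 < m)%N -> (l * m = l1 * l2)%N ->
    (forall k, (start psi <= k)%N -> (psi k)%:Z = alpha + (l * k)%N%:Z) ->
    tail_subsequence phi (start phi + start phi1 + start phi2 + start psi) psi.
  move=> m0 lm Epsi; split; first by lia.
  exists (fun k => m * k)%N; split=> [k hk|k k' _ hkk']; last by rewrite ltn_pmul2l.
  have hmk : (k <= m * k)%N by apply: leq_pmull.
  have hs : (start psi <= m * k)%N by lia.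
  split=> //.
  have := E k ltac:(lia); have := Epsi _ hs; rewrite mulnA lm; lia.
have ext n n' psi : (n <= n')%N -> tail_subsequence phi n psi ->
    tail_subsequence phi n' psi.
  move=> nn' [hs [j [j1 j2]]]; split; first exact: leq_trans nn'.
  by exists j; split=> [k hk|k l hk]; [apply: j1|apply: j2]; apply: leq_trans hk.
exists phi, (start phi + start phi1 + start phi2 + (start phi1 + start phi2))%N.
split; first by exists (l1 * l2)%N.
- by apply: ext (sub l1 l2 phi1 l2_gt0 erefl E1); lia.
- by apply: ext (sub l2 l1 phi2 l1_gt0 (mulnC _ _) E2); lia.
Qed.

Definition Phi_ (alpha : int) : interlocked_family :=
  InterlockedFamily (arith_paths_nonempty alpha) (@arith_paths_interlocked alpha).

Lemma expr_add1_mid (A : comNzRingType) (m : nat) (y : A) : (0 < m)%N ->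
  (y + 1) ^+ m =
  1 + (\sum_(i < m.-1) y ^+ i.+1 *+ 'C(m, i.+1) + y ^+ m).
Proof.
case: m => // q _; rewrite addrC exprDn.
under eq_bigr => i _ do rewrite expr1n mul1r.
rewrite big_ord_recl /= expr0 bin0 mulr1n; congr (_ + _).
rewrite big_ord_recr /= /bump /= !add1n binn mulr1n.
by congr (_ + _); apply: eq_bigr.
Qed.

Section Integral.
Variables (R : realType) (p : nat) (K : Cp_field R p).
Implicit Types (f : K -> K) (a b x z : K).

(* The sum is finite; its nodes lie in [arc a b] (see [node_in_arc]), so the
   values of [f] elsewhere are irrelevant. *)
Definition path_average f a b (phi : path_seq) (k : nat) : K :=
  ((p%:R : K) ^+ phi k)^-1 *
  \sum_(z \in [set z : K | (p ^ phi k).-unity_root z])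
     ((a + (b - a) * z - a) * f (a + (b - a) * z)).

(* The integral of [f] over the arc from [a] to [b] relative to [Phi] exists
   and equals [L]. *)
Definition has_integral f a b (Phi : interlocked_family) (L : K) : Prop :=
  forall e : R, 0 < e -> exists2 phi : path_seq, family Phi phi &
    exists N : nat, forall k, (start phi <= k)%N -> (N < k)%N ->
      absp K (path_average f a b phi k - L) < e.

(* The value [0] is also taken on [absp K x > 1], where the character is not
   defined. *)
Definition teichmuller x : K :=
  if absp K x == 1 then
    xget 0 [set w : K | (exists2 m : nat, coprime m p & m.-primitive_root w) /\
                        absp K (x - w) < 1]
  else 0.

(* Both one-sided series have to converge. *)
Definition laurent_sum (c : int -> K) (y s : K) : Prop :=
  exists s1 s2 : K,
    [/\ abs_cvg (absp K) (fun N => \sum_(0 <= n < N) c n%:Z * y ^ n%:Z) s1,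
        abs_cvg (absp K)
          (fun N => \sum_(0 <= n < N) c (- n.+1%:Z) * y ^ (- n.+1%:Z)) s2
      & s = s1 + s2].

Lemma absp_ultrametric : is_ultrametric_abs (absp K).
Proof. exact: compl_abs (Cp_completion K). Qed.

Let aE0 := uabs_eq0 absp_ultrametric.
Let aM := uabsM absp_ultrametric.
Let aD := uabsD absp_ultrametric.
Let a_ge0 := uabs_ge0 absp_ultrametric.

Lemma absp1 : absp K 1 = 1.
Proof.
have n0 : absp K 1 != 0 by apply/eqP => /aE0/eqP; rewrite oner_eq0.
by apply: (mulfI n0); rewrite -aM !mulr1.
Qed.

Lemma absp0 : absp K 0 = 0.
Proof. exact/aE0. Qed.

Lemma abspX x n : absp K (x ^+ n) = absp K x ^+ n.
Proof. by elim: n => [|n IH]; rewrite ?expr0 ?absp1 // !exprS aM IH. Qed.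

Lemma abspN x : absp K (- x) = absp K x.
Proof.
have h : absp K (-1) = 1.
  by apply/eqP; rewrite -(@pexpr_eq1 _ _ 2) // -abspX sqrrN expr1n absp1.
by rewrite -mulN1r aM h mul1r.
Qed.

Lemma absp_nat_le1 n : absp K n%:R <= 1.
Proof.
elim: n => [|n IH]; first by rewrite absp0.
by rewrite -natr1 (le_trans (aD _ _)) // ge_max IH absp1 /=.
Qed.

Lemma absp_p : prime p -> absp K p%:R = p%:R^-1.
Proof.
move=> pp.
have -> : (p%:R : K) = Qpbar_to_Cp K (Qp_to_Qpbar K (rat_to_Qp K p%:R)).
  by rewrite !rmorph_nat.
rewrite (compl_isometry (Cp_completion K)) absQpbar_extends.
rewrite (compl_isometry (Qp_completion K)) /padic_abs.
have p_gt0 := prime_gt0 pp.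
rewrite pnatr_eq0 eqn0Ngt p_gt0 /=.
have -> : denq p%:R = 1 by rewrite -[p%:R]/(p%:~R) denq_int.
have -> : numq p%:R = p%:Z by rewrite -[p%:R]/(p%:~R) numq_int.
by rewrite absz1 logn1 absz_nat logn_prime // eqxx expr0 expr1 mul1r.
Qed.

Lemma absp_unity_root_sub1 n z : prime p -> (p ^ n).-unity_root z ->
  absp K (z - 1) < 1.
Proof.
move=> pp; rewrite unity_rootE => /eqP; elim: n z => [|n IH] z hz.
  by move: hz; rewrite expn0 expr1 => ->; rewrite subrr absp0.
have hzp : absp K (z ^+ p - 1) < 1 by apply: IH; rewrite -exprM -expnS.
have z1 : absp K z = 1.
  apply/eqP; rewrite -(@pexpr_eq1 _ _ (p ^ n.+1)) ?expn_gt0 ?prime_gt0 //.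
  by rewrite -abspX hz absp1.
set y := z - 1.
have y1 : absp K y <= 1.
  by rewrite (le_trans (aD _ _)) // abspN z1 absp1 maxxx.
have zE : z = y + 1 by rewrite subrK.
set mid := \sum_(i < p.-1) y ^+ i.+1 *+ 'C(p, i.+1).
have e : y ^+ p = (z ^+ p - 1) - mid.
  have -> : z ^+ p = 1 + (mid + y ^+ p).
    by rewrite zE expr_add1_mid ?prime_gt0.
  by rewrite [1 + _]addrC addrK addrC addrA addNr add0r.
have mid_lt : absp K mid < 1.
  rewrite /mid; elim/big_ind: _ => [|u v hu hv|i _]; first by rewrite absp0.
    by rewrite (le_lt_trans (aD _ _)) // gt_max hu hv.
  have /dvdnP[d ->] : (p %| 'C(p, i.+1))%N.
    by apply: prime_dvd_bin => //=; rewrite -ltn_predRL ltn_ord.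
  rewrite -mulr_natr natrM mulrA aM aM absp_p //.
  apply: (@le_lt_trans _ _ (p%:R^-1)).
    rewrite ler_piMl ?invr_ge0 //.
    by rewrite mulr_ile1 ?a_ge0 ?absp_nat_le1 // abspX exprn_ile1 ?a_ge0.
  by rewrite invf_lt1 ?ltr0n ?ltr1n ?prime_gt1 ?prime_gt0.
have : absp K (y ^+ p) < 1.
  by rewrite e (le_lt_trans (aD _ _)) // abspN gt_max hzp mid_lt.
by rewrite abspX !ltNge; apply: contra => y_ge1; rewrite exprn_ege1.
Qed.

Lemma node_in_arc n a b z : prime p -> a != b -> (p ^ n).-unity_root z ->
  arc a b (a + (b - a) * z).
Proof.
move=> pp ab hz; rewrite /arc /=.
have -> : a + (b - a) * z - b = (b - a) * (z - 1).
  by rewrite mulrBr mulr1 opprB addrAC addrC.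
have ab_gt0 : 0 < absp K (a - b).
  rewrite lt0r a_ge0 andbT.
  by apply/eqP => /aE0/eqP; rewrite subr_eq0 (negbTE ab).
rewrite aM -(opprB a b) abspN gtr_pMr //.
exact: absp_unity_root_sub1 hz.
Qed.

End Integral.

(* Main.v *)
Require Import Defs.
From mathcomp Require Import all_boot all_order all_algebra.
From mathcomp Require Import all_classical all_reals all_analysis.
From mathcomp Require Import cyclic separable cyclotomic ring zify.
Import Order.TTheory GRing.Theory Num.Theory.
Import numFieldNormedType.Exports.
Local Open Scope classical_set_scope.
Local Open Scope ring_scope.
Set Implicit Arguments.
Unset Strict Implicit.

(* Put [t = (a - x0) / (a - b)], so that the node given by [z] satisfies
   [x - x0 = (b - a) (z - t)] with [`|t| <= 1] and [`|1 - t| = 1], and let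
   [q = p ^ n].  The average is then a combination of the means over
   [z ^ q = 1] of [z (z - t) ^ m] for [m] an integer.  All these means have
   absolute value at most 1.  Those with [0 <= m < q - 1] vanish, the one with
   [m = -1] is [1 / (1 - t ^ q)], and for fixed [m < -1] they tend to 0 with
   [q]: they are the Taylor coefficients at [t] of [1 / (1 - X ^ q)], and
   [C(q, j)] tends to 0 for fixed [j > 0].  As the coefficients of the series
   tend to 0, only the term [m = -1] survives, and [t ^ q] tends to
   [omega(t) ^ (p ^ alpha)] along [q = p ^ (alpha + l k)] as soon as
   [omega(t) ^ (p ^ l) = omega(t)].

   The character exists because the residue field of [C_p] is algebraic over
   the prime field: the powers of an element of absolute value 1 take finitely
   many values modulo the maximal ideal, hence [`|t ^ d - 1| < 1] for some [d]
   prime to [p], and one of the factors [t - w] of [t ^ d - 1] is small. *)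

(** * Means over the roots of unity of order [n] in a field *)

Section RootMeans.
Variables (F : fieldType) (n : nat) (z : F).
Hypotheses (zP : n.-primitive_root z) (n_neq0 : n%:R != 0 :> F).

Definition root_mean (g : F -> F) : F := n%:R^-1 * \sum_(i < n) g (z ^+ i).

Lemma eq_root_mean g h : (forall i : nat, g (z ^+ i) = h (z ^+ i)) ->
  root_mean g = root_mean h.
Proof. by move=> gh; congr (_ * _); apply: eq_bigr => i _. Qed.

Lemma root_meanD g h :
  root_mean (fun x => g x + h x) = root_mean g + root_mean h.
Proof. by rewrite /root_mean big_split mulrDr. Qed.

Lemma root_meanZ k g : root_mean (fun x => k * g x) = k * root_mean g.
Proof. by rewrite /root_mean -mulr_sumr mulrCA. Qed.

Lemma root_mean_sum N (g : nat -> F -> F) :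
  root_mean (fun x => \sum_(j < N) g j x) = \sum_(j < N) root_mean (g j).
Proof. by rewrite /root_mean exchange_big mulr_sumr. Qed.

(** If [n] does not divide [m], the nonzero factor [z ^+ m - 1] turns the geometric sum of the
    powers of [z ^+ m] into 0. *)
Lemma root_mean_exp m : root_mean (fun x => x ^+ m) = (n %| m)%N%:R.
Proof.
have [nm|nm] := boolP (n %| m)%N.
  rewrite /root_mean (eq_bigr (fun=> 1)) => [|i _].
    by rewrite sumr_const card_ord mulVf.
  by rewrite exprAC (eqP (_ : z ^+ m == 1)) ?expr1n // -(prim_order_dvd zP).
have zm1 : z ^+ m - 1 != 0 by rewrite subr_eq0 -(prim_order_dvd zP).
apply: (mulfI zm1); rewrite mulr0 /root_mean mulrCA.
rewrite (eq_bigr (fun i : 'I_n => (z ^+ m) ^+ i)) => [|i _]; last exact: exprAC.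
by rewrite -subrX1 exprAC (prim_expr_order zP) expr1n subrr mulr0.
Qed.

Variable t : F.

(** The factor [x] comes from the weight [x - a] of the path average. The two means belong to the
    Laurent terms of degree [m] and [- k.+1], so [pole_mean 0] carries the residue. *)
Definition shift_mean m := root_mean (fun x => x * (x - t) ^+ m).
Definition pole_mean k := root_mean (fun x => x / (x - t) ^+ k.+1).

(** After binomial expansion only the powers of [x] with exponent divisible by [n] keep a nonzero
    mean. *)
Lemma shift_meanE m : shift_mean m =
  \sum_(i < m.+1) ((- t) ^+ (m - i) *+ 'C(m, i)) * (n %| i.+1)%N%:R.
Proof.
under eq_bigr => i _ do rewrite -root_mean_exp -root_meanZ.
rewrite -(root_mean_sum m.+1
  (fun i x => ((- t) ^+ (m - i) *+ 'C(m, i)) * x ^+ i.+1)).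
apply: eq_root_mean => i; rewrite addrC exprDn mulr_sumr.
by apply: eq_bigr => j _; rewrite exprS -mulrnAl mulrCA.
Qed.

Lemma shift_mean_small m : (m.+1 < n)%N -> shift_mean m = 0.
Proof.
move=> mn; rewrite shift_meanE big1 // => i _.
by rewrite gtnNdvd ?mulr0 // (leq_ltn_trans _ mn).
Qed.

Lemma shift_mean_pred : shift_mean n.-1 = 1.
Proof.
have n0 := prim_order_gt0 zP.
rewrite shift_meanE big_ord_recr /= big1 ?add0r => [|i _].
  by rewrite subnn binn prednK // dvdnn !mulr1.
by rewrite gtnNdvd ?mulr0 // -ltn_predRL.
Qed.

Hypothesis pole_free : forall i : nat, z ^+ i - t != 0.

(* Multiply the summand by [1 = x ^+ n = (t + (x - t)) ^+ n] and expand: the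
   terms of degree [> k] in [x - t] contribute shifted means, all of which
   vanish but that of degree [n.-1]. *)
Lemma pole_mean_rec k : pole_mean k =
  \sum_(j < k.+1) (t ^+ (n - j) *+ 'C(n, j)) * pole_mean (k - j)
  + (k == 0%N)%:R.
Proof.
have n0 := prim_order_gt0 zP.
pose a j := t ^+ (n - j) *+ 'C(n, j).
have -> : pole_mean k =
    root_mean (fun x => \sum_(j < k.+1) a j * (x / (x - t) ^+ (k - j).+1) +
      \sum_(i < n) a (k.+1 + i)%N * (x * (x - t) ^+ i)).
  apply: eq_root_mean => i; have := pole_free i; set x := z ^+ i => u0.
  have e : \sum_(j < k.+1 + n) a j * (x - t) ^+ j = 1.
    have -> : 1 = (t + (x - t)) ^+ n.
      by rewrite addrC subrK /x exprAC (prim_expr_order zP) expr1n.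
    rewrite exprDn; under [RHS]eq_bigr => j _ do rewrite -mulrnAl.
    (* The binomial coefficients beyond [n] are 0, so the sum may be widened; it then splits at
       [k.+1] for every [k]. *)
    rewrite [RHS](big_ord_widen (k.+1 + n) (fun j => a j * (x - t) ^+ j)).
      rewrite [RHS]big_mkcond; apply: eq_bigr => j _.
      by case: ifPn => //; rewrite -leqNgt => nj; rewrite /a bin_small // mul0r.
    by rewrite addSn ltnS leq_addl.
  rewrite -[LHS]mulr1 -{}e mulr_sumr big_split_ord /=; congr (_ + _).
    apply: eq_bigr => j _; rewrite mulrCA; congr (_ * _).
    rewrite -mulrA; congr (_ * _).
    have -> : (x - t) ^+ k.+1 = (x - t) ^+ (k - j).+1 * (x - t) ^+ j.
      by rewrite -exprD addSn subnK // -ltnS.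
    by rewrite invfM -mulrA mulVf ?mulr1 // expf_neq0.
  apply: eq_bigr => j _; rewrite mulrCA; congr (_ * _).
  by rewrite exprD mulrA divfK // expf_neq0.
rewrite root_meanD.
rewrite (root_mean_sum k.+1 (fun j x => a j * (x / (x - t) ^+ (k - j).+1))).
rewrite (root_mean_sum n (fun i x => a (k.+1 + i)%N * (x * (x - t) ^+ i))).
congr (_ + _); first by apply: eq_bigr => j _; rewrite root_meanZ.
under eq_bigr => i _ do rewrite root_meanZ.
rewrite -(big_mkord xpredT (fun i => a (k.+1 + i)%N * shift_mean i)).
(* Only [i = n.-1] survives, with coefficient [a (k + n)]: 1 for [k = 0] and 0 otherwise. *)
rewrite -[X in index_iota _ X](prednK n0) big_nat_recr //= big_nat big1 => [|i].
  rewrite add0r shift_mean_pred mulr1 /a addSn -addnS prednK //.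
  case: k => [|k]; first by rewrite add0n subnn binn.
  by rewrite bin_small ?mulr0n // addSn ltnS leq_addl.
by case/andP=> _ ik; rewrite shift_mean_small ?mulr0 // -ltn_predRL.
Qed.

End RootMeans.

(** * Ultrametric estimates and the effect of [p]-th powers *)

Section AbsoluteValue.
Variables (R : realType) (p : nat) (K : Cp_field R p).
Implicit Types (x y : K) (e : R).

Lemma absp_ge0 x : 0 <= absp K x.
Proof. exact: uabs_ge0 (absp_ultrametric K) x. Qed.

Lemma abspM x y : absp K (x * y) = absp K x * absp K y.
Proof. exact: uabsM (absp_ultrametric K) x y. Qed.

Lemma absp_eq0 x : (absp K x == 0) = (x == 0).
Proof.
by apply/eqP/eqP => h; apply/(uabs_eq0 (absp_ultrametric K) x).
Qed.

Lemma absp_gt0 x : (0 < absp K x) = (x != 0).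
Proof. by rewrite lt0r absp_eq0 absp_ge0 andbT. Qed.

Lemma abspD_le x y e : absp K x <= e -> absp K y <= e -> absp K (x + y) <= e.
Proof.
move=> hx hy; apply: le_trans (uabsD (absp_ultrametric K) x y) _.
by rewrite ge_max hx.
Qed.

Lemma abspD_lt x y e : absp K x < e -> absp K y < e -> absp K (x + y) < e.
Proof.
move=> hx hy; apply: le_lt_trans (uabsD (absp_ultrametric K) x y) _.
by rewrite gt_max hx.
Qed.

Lemma abspB_le x y e : absp K x <= e -> absp K y <= e -> absp K (x - y) <= e.
Proof. by move=> hx hy; apply: abspD_le; rewrite ?abspN. Qed.

Lemma abspB_lt x y e : absp K x < e -> absp K y < e -> absp K (x - y) < e.
Proof. by move=> hx hy; apply: abspD_lt; rewrite ?abspN. Qed.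

Lemma abspBC x y : absp K (x - y) = absp K (y - x).
Proof. by rewrite -abspN opprB. Qed.

Lemma absp_trans_lt x y z e :
  absp K (x - y) < e -> absp K (y - z) < e -> absp K (x - z) < e.
Proof. by move=> hx hy; rewrite -(subrKA y); apply: abspD_lt. Qed.

Lemma abspD_eq x y : absp K y < absp K x -> absp K (x + y) = absp K x.
Proof.
move=> yx; apply/eqP; rewrite eq_le (abspD_le (lexx _) (ltW yx)) /=.
rewrite leNgt; apply/negP => h; have := abspB_lt h yx.
by rewrite addrK ltxx.
Qed.

Lemma abspV x : absp K x^-1 = (absp K x)^-1.
Proof.
have [->|x0] := eqVneq x 0; first by rewrite invr0 absp0 invr0.
have n0 : absp K x != 0 by rewrite absp_eq0.
by apply: (mulfI n0); rewrite -abspM !mulfV // absp1.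
Qed.

Lemma absp_sum_le I (s : seq I) (P : pred I) (F : I -> K) e : 0 <= e ->
  (forall i, P i -> absp K (F i) <= e) -> absp K (\sum_(i <- s | P i) F i) <= e.
Proof.
move=> e0 h; elim/big_ind: _ => [|x y|]; first by rewrite absp0.
  exact: abspD_le.
exact: h.
Qed.

Lemma absp_sum_lt I (s : seq I) (P : pred I) (F : I -> K) e : 0 < e ->
  (forall i, P i -> absp K (F i) < e) -> absp K (\sum_(i <- s | P i) F i) < e.
Proof.
move=> e0 h; elim/big_ind: _ => [|x y|]; first by rewrite absp0.
  exact: abspD_lt.
exact: h.
Qed.

Lemma abspM_le1 x y e : absp K x <= 1 -> absp K y <= e -> absp K (x * y) <= e.
Proof.
move=> hx hy; rewrite abspM (le_trans _ hy) //.
by rewrite ler_piMl ?absp_ge0.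
Qed.

Lemma abspX_le1 x n : absp K x <= 1 -> absp K (x ^+ n) <= 1.
Proof. by move=> hx; rewrite abspX exprn_ile1 ?absp_ge0. Qed.

Lemma abspMn_le x n e : absp K x <= e -> absp K (x *+ n) <= e.
Proof. by move=> hx; rewrite -mulr_natl abspM_le1 ?absp_nat_le1. Qed.

Lemma absp_expr1 x n : (0 < n)%N -> absp K (x ^+ n) = 1 -> absp K x = 1.
Proof.
move=> n0; rewrite abspX => /eqP; rewrite pexpr_eq1 ?absp_ge0 //.
by move/eqP.
Qed.

Definition rat_to_Cp : {rmorphism rat -> K} :=
  (Qpbar_to_Cp K) \o ((Qp_to_Qpbar K) \o (rat_to_Qp K)).

Lemma natrK_eq0 n : (n%:R == 0 :> K) = (n == 0%N).
Proof. by rewrite -(rmorph_nat rat_to_Cp) fmorph_eq0 pnatr_eq0. Qed.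

Lemma absp_embed (x : Qp K) :
  absp K (Qpbar_to_Cp K (Qp_to_Qpbar K x)) = absQp x.
Proof.
by rewrite (compl_isometry (Cp_completion K)) absQpbar_extends.
Qed.

Hypothesis p_prime : prime p.

Lemma p_inv_lt1 : p%:R^-1 < 1 :> R.
Proof. by rewrite invf_lt1 ?ltr0n ?ltr1n ?prime_gt1 ?prime_gt0. Qed.

Lemma absp_pX n : absp K (p ^ n)%:R = p%:R^-1 ^+ n.
Proof. by rewrite natrX abspX absp_p. Qed.

(** The middle terms of [(y + d) ^+ p], with [d = x - y], have a coefficient divisible by [p] and
    contain a factor [d]. *)
Lemma absp_frobenius x y : absp K y <= 1 -> absp K (x - y) <= 1 ->
  absp K (x ^+ p - y ^+ p - (x - y) ^+ p) <= absp K (x - y) / p%:R.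
Proof.
move=> y1; set d := x - y => d1.
have p0 := prime_gt0 p_prime.
have -> : x = y + d by rewrite addrC subrK.
rewrite exprDn -(big_mkord xpredT (fun i => y ^+ (p - i) * d ^+ i *+ 'C(p, i))).
rewrite big_nat_recr //= subnn expr0 mul1r binn addrAC addrK.
rewrite big_ltn // subn0 expr0 mulr1 bin0 mulr1n addrC addKr big_nat.
apply: absp_sum_le => [|i /andP[i0 ip]].
  by rewrite mulr_ge0 ?absp_ge0.
have /dvdnP[m ->] : (p %| 'C(p, i))%N by apply: prime_dvd_bin => //; rewrite i0.
rewrite -mulr_natl natrM mulrAC abspM absp_p // ler_pM ?absp_ge0 //.
  rewrite abspM_le1 ?absp_nat_le1 // abspM_le1 ?abspX_le1 //.
by rewrite -(prednK i0) exprSr abspM_le1 ?abspX_le1.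
Qed.

(** Raising to the power [p] is injective on residues: [(x - y) ^+ p] and [x ^+ p - y ^+ p] differ
    by at most [1 / p]. *)
Lemma absp_sub_pX_lt1 x y : absp K y <= 1 -> absp K (x - y) <= 1 ->
  absp K (x ^+ p - y ^+ p) < 1 -> absp K (x - y) < 1.
Proof.
move=> y1 d1 h; suff : absp K ((x - y) ^+ p) < 1.
  by rewrite abspX !ltNge; apply: contra => /exprn_ege1->.
rewrite -[_ ^+ p](subKr (x ^+ p - y ^+ p)) abspB_lt //.
apply: le_lt_trans (absp_frobenius _ _) _ => //.
by rewrite (le_lt_trans _ p_inv_lt1) // ler_piMl ?invr_ge0.
Qed.

(** Each [p]-th power gains a factor [e]: the middle terms gain [1 / p], and [(x - y) ^+ p] gains a
    further [absp K (x - y)] because [p >= 2]. *)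
Lemma absp_sub_exp_pX_le x y e n : p%:R^-1 <= e -> e <= 1 -> absp K y <= 1 ->
  absp K (x - y) <= e -> absp K (x ^+ (p ^ n) - y ^+ (p ^ n)) <= e ^+ n.+1.
Proof.
move=> pe e1 y1 xy; have e0 : 0 <= e by rewrite (le_trans _ pe) ?invr_ge0.
elim: n => [|n IH]; first by rewrite expn0 !expr1.
rewrite expnSr !exprM; move: (x ^+ _) (y ^+ _) (abspX_le1 (p ^ n) y1) IH.
clear x y y1 xy => x y y1 xy.
have xy1 : absp K (x - y) <= 1 by rewrite (le_trans xy) ?exprn_ile1.
rewrite -(subrK ((x - y) ^+ p) (x ^+ p - y ^+ p)) abspD_le //.
  apply: le_trans (absp_frobenius y1 xy1) _.
  by rewrite [e ^+ n.+2]exprSr ler_pM ?absp_ge0 ?invr_ge0.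
rewrite abspX; set d := absp K (x - y) in xy xy1 *.
have d0 : 0 <= d := absp_ge0 _.
apply: le_trans (ler_wiXn2l d0 xy1 (prime_gt1 p_prime)) _.
rewrite expr2 [e ^+ n.+2]exprSr ler_pM // (le_trans xy) //.
by rewrite exprS ler_piMr ?exprn_ile1.
Qed.

Lemma absp_sub_exp_cvg x y e : absp K y <= 1 -> absp K (x - y) < 1 -> 0 < e ->
  exists N, forall n, (N <= n)%N -> absp K (x ^+ (p ^ n) - y ^+ (p ^ n)) < e.
Proof.
move=> y1 xy e0; pose rho := Num.max (absp K (x - y)) p%:R^-1.
have rho0 : 0 <= rho by rewrite le_max absp_ge0.
have rho1 : rho < 1 by rewrite gt_max xy p_inv_lt1.
have [N _ hN] : \forall n \near \oo, rho ^+ n < e.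
  have : `|rho| < 1 by rewrite ger0_norm.
  move=> /cvg_expr /cvgrPdist_lt /(_ e e0).
  by apply: filterS => n; rewrite sub0r normrN ger0_norm ?exprn_ge0.
exists N => n Nn.
have h : p%:R^-1 <= rho by rewrite le_max lexx orbT.
have h' : absp K (x - y) <= rho by rewrite le_max lexx.
apply: le_lt_trans (absp_sub_exp_pX_le n h (ltW rho1) y1 h') _.
by apply: hN; rewrite /= leqW.
Qed.

End AbsoluteValue.

(** * Bounds on the means for [q = p ^ n] *)

Section RootMeanBounds.
Variables (R : realType) (p : nat) (K : Cp_field R p).
Hypothesis p_prime : prime p.
Variables (n : nat) (z t : K).
Hypotheses (zP : (p ^ n).-primitive_root z) (t1 : absp K t <= 1)
  (t1' : absp K (1 - t) = 1).
Local Notation q := (p ^ n)%N.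

Let q_neq0 : q%:R != 0 :> K.
Proof. by rewrite natrK_eq0 -lt0n expn_gt0 prime_gt0. Qed.

(** A root of unity of [p]-power order has residue 1, so [z ^+ i - t] has the nonzero residue of
    [1 - t]. *)
Lemma absp_node_sub i : absp K (z ^+ i - t) = 1.
Proof.
rewrite -(subrKA 1) addrC abspD_eq // t1'.
apply: (@absp_unity_root_sub1 _ _ _ n) => //.
by rewrite unity_rootE exprAC (prim_expr_order zP) expr1n.
Qed.

Let pole_free i : z ^+ i - t != 0.
Proof. by rewrite -absp_gt0 absp_node_sub. Qed.

(** The product of the [t - z ^+ i], all of absolute value 1, is [t ^+ q - 1]. *)
Lemma absp_1_sub_exp : absp K (1 - t ^+ q) = 1.
Proof.
have /(congr1 (horner^~ t)) := factor_Xn_sub_1 zP.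
rewrite horner_prod hornerD hornerN hornerXn hornerC abspBC => <-.
elim/big_ind: _ => [|x y hx hy|i _]; first exact: absp1.
  by rewrite abspM hx hy mulr1.
by rewrite hornerXsubC abspBC absp_node_sub.
Qed.

(** The mean divides by [q], whose absolute value is small; in the closed form [shift_meanE] this
    division is gone. *)
Lemma shift_mean_le1 m : absp K (shift_mean q z t m) <= 1.
Proof.
rewrite shift_meanE //; apply: absp_sum_le => // i _.
by rewrite abspM_le1 ?absp_nat_le1 // abspMn_le // abspX_le1 ?abspN.
Qed.

(** The term [j = 0] of the recursion is [t ^+ q] times the unknown; moved to the left it leaves the
    factor [1 - t ^+ q], of absolute value 1. *)
Lemma pole_meanE k : (1 - t ^+ q) * pole_mean q z t k =
  \sum_(j < k) (t ^+ (q - j.+1) *+ 'C(q, j.+1)) * pole_mean q z t (k - j.+1)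
  + (k == 0%N)%:R.
Proof.
rewrite mulrBl mul1r {1}(pole_mean_rec zP q_neq0 pole_free) big_ord_recl /=.
by rewrite !subn0 bin0 mulr1n addrAC [X in X + _]addrAC subrr add0r.
Qed.

Lemma pole_mean_le1 k : absp K (pole_mean q z t k) <= 1.
Proof.
elim/ltn_ind: k => k IH.
rewrite -[leLHS]mul1r -[X in X * _]absp_1_sub_exp -abspM pole_meanE.
apply: abspD_le; last exact: absp_nat_le1.
apply: absp_sum_le => // j _.
rewrite abspM_le1 ?abspMn_le ?abspX_le1 // IH //.
by rewrite ltn_subrL /= (leq_ltn_trans _ (ltn_ord j)).
Qed.

Lemma pole_mean0 : pole_mean q z t 0 = (1 - t ^+ q)^-1.
Proof.
have u0 : 1 - t ^+ q != 0 by rewrite -absp_gt0 absp_1_sub_exp.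
by apply: (mulfI u0); rewrite pole_meanE big_ord0 add0r mulfV.
Qed.

(** From [j.+1 * 'C(q, j.+1) = q * 'C(q.-1, j)]; as [j.+1] divides the factorial of [k], the bound
    is uniform in [j < k]. *)
Lemma absp_bin_le j k : (j < k)%N ->
  absp K 'C(q, j.+1)%:R <= p%:R^-1 ^+ n / absp K k`!%:R.
Proof.
move=> jk; have f0 : 0 < absp K k`!%:R.
  by rewrite absp_gt0 natrK_eq0 -lt0n fact_gt0.
rewrite ler_pdivlMr // -abspM -natrM mulnC.
have /dvdnP[c ->] : (j.+1 %| k`!)%N by apply: dvdn_fact; rewrite jk.
rewrite -mulnA -mul_bin_diag mulnCA natrM mulrC abspM_le1 ?absp_nat_le1 //.
by rewrite absp_pX.
Qed.

(** For [k > 0] every term of the recursion contains some ['C(q, j.+1)] with [j < k]. *)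
Lemma pole_mean_le k : (0 < k)%N ->
  absp K (pole_mean q z t k) <= p%:R^-1 ^+ n / absp K k`!%:R.
Proof.
move=> k0; rewrite -[leLHS]mul1r -[X in X * _]absp_1_sub_exp -abspM pole_meanE.
rewrite eqn0Ngt k0 addr0; apply: absp_sum_le => [|j _].
  by rewrite divr_ge0 ?absp_ge0 ?exprn_ge0 ?invr_ge0.
rewrite mulrC abspM_le1 ?pole_mean_le1 // -mulr_natr abspM_le1 ?abspX_le1 //.
exact: absp_bin_le.
Qed.

End RootMeanBounds.

(** * Roots of unity in [K] *)

Section RootsOfUnity.
Variables (R : realType) (p : nat) (K : Cp_field R p).

(** The polynomial ['X^n - 1], separable in characteristic 0, is split in the algebraically closed
    [Qpbar], and a primitive root is mapped to [K]. *)
Lemma Cp_prim_root_exists n : (0 < n)%N -> exists z : K, n.-primitive_root z.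
Proof.
move=> n0.
have [rs /esym e] := closed_field_poly_normal ('X^n - 1 : {poly Qpbar K}).
have mon : 'X^n - 1 \is @monic (Qpbar K) by apply: monicXnsubC.
rewrite (monicP mon) scale1r in e.
have us : uniq rs.
  rewrite -separable_prod_XsubC e separable_Xn_sub_1 //.
  rewrite -(fmorph_eq0 (Qpbar_to_Cp K)) rmorph_nat natrK_eq0.
  by rewrite -lt0n.
have sz : size rs = n.
  by apply: succn_inj; rewrite -(size_prod_XsubC rs idfun) e size_XnsubC.
have al : all n.-unity_root rs.
  by apply/allP=> z zr; rewrite /= /root_of_unity -e root_prod_XsubC.
have /hasP[z _ zP] := has_prim_root n0 al us (eq_leq (esym sz)).
by exists (Qpbar_to_Cp K z); rewrite fmorph_primitive_root.
Qed.

Lemma sum_unity_root n (z : K) (F : K -> K) : n.-primitive_root z ->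
  \sum_(x \in [set x : K | n.-unity_root x]) F x = \sum_(i < n) F (z ^+ i).
Proof.
move=> zP; pose s := [seq z ^+ (i : 'I_n) | i <- enum 'I_n].
have us : uniq s.
  rewrite map_inj_uniq ?enum_uniq // => i j /eqP.
  rewrite (eq_prim_root_expr zP) !modn_small // => /eqP.
  exact: ord_inj.
have -> : [set x : K | n.-unity_root x] = [set` s].
  apply/seteqP; split=> x /=.
    rewrite unity_rootE => /eqP /(prim_rootP zP)[i ->].
    by apply: map_f; rewrite mem_enum.
  case/mapP=> i _ ->.
  by rewrite unity_rootE exprAC (prim_expr_order zP) expr1n.
by rewrite -(fsbig_seq _ _ us) big_map big_enum.
Qed.

End RootsOfUnity.

(** * A pigeonhole principle and a last maximum *)

Lemma nat_pigeonhole (T : finType) (h : nat -> T) :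
  exists i j, (i < j)%N /\ h i = h j.
Proof.
pose g (i : 'I_#|T|.+1) := h i.
have /injectivePn[i [j ij gij]] : ~~ injectiveb g.
  apply/negP => /injectiveP /leq_card; rewrite card_ord.
  by rewrite ltnn.
have [ij'|ji|/val_inj ij'] := ltngtP i j; first by exists i, j.
- by exists j, i.
- by rewrite ij' eqxx in ij.
Qed.

(** Applied to the absolute values of the coefficients of a polynomial, the last maximum gives the
    degree of its reduction. *)
Lemma last_argmax (R : realType) (u : nat -> R) n :
  exists2 i, (i <= n)%N &
    forall j, (j <= n)%N -> u j <= u i /\ ((i < j)%N -> u j < u i).
Proof.
elim: n => [|n [i ilen hi]].
  by exists 0%N => // j; rewrite leqn0 => /eqP->; rewrite lexx.
have [h|h] := leP (u i) (u n.+1).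
  exists n.+1 => // j; rewrite leq_eqVlt => /orP[/eqP->|].
    by rewrite lexx ltnn.
  rewrite ltnS => jn; split; first exact: le_trans (hi j jn).1 h.
  by rewrite ltnNge (leq_trans jn).
exists i => [|j]; first exact: leqW.
by rewrite leq_eqVlt => /orP[/eqP->|/hi//]; rewrite (ltW h).
Qed.

(** * Residues, and existence of the Teichmüller representative *)

Section Residues.
Variables (R : realType) (p : nat) (K : Cp_field R p).
Hypothesis p_prime : prime p.
Implicit Types (x y : K) (m : int).

Lemma absp_int_le1 m : absp K m%:~R <= 1.
Proof.
by case: m => m; rewrite ?NegzE ?mulrNz ?abspN absp_nat_le1.
Qed.

Lemma absp_int_dvd_lt1 m : (p%:Z %| m)%Z -> absp K m%:~R < 1.
Proof.
case/dvdzP=> c ->; rewrite intrM.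
apply: le_lt_trans (p_inv_lt1 R p_prime).
by rewrite abspM_le1 ?absp_int_le1 // absp_p.
Qed.

Lemma absp_int_coprime m : coprimez m p -> absp K m%:~R = 1.
Proof.
case/coprimezP=> -[u v] /= e; apply/eqP; rewrite eq_le absp_int_le1 /= leNgt.
apply/negP => h; have := ltxx (1 : R); rewrite -{1}(absp1 K).
have <- : (u * m + v * p%:Z)%:~R = 1 :> K by rewrite e.
rewrite intrD intrM abspD_lt //; last by rewrite absp_int_dvd_lt1 ?dvdz_mull.
by rewrite abspM (le_lt_trans _ h) // ler_piMl ?absp_ge0 ?absp_int_le1.
Qed.

(** If [p] divided the denominator it would divide the numerator too. So [denq r] has an inverse [u]
    modulo [p], and [m = numq r * u]. *)
Lemma rat_residue (r : rat) : absp K (rat_to_Cp K r) <= 1 ->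
  exists m, absp K (rat_to_Cp K r - m%:~R) < 1.
Proof.
set rho := rat_to_Cp K r; set d : K := (denq r)%:~R.
have d0 : d != 0.
  by rewrite /d -(rmorph_int (rat_to_Cp K)) fmorph_eq0 intr_eq0 denq_eq0.
have rhoE : rho * d = (numq r)%:~R.
  rewrite /d -!(rmorph_int (rat_to_Cp K)) -rmorphM -{1}[r]divq_num_den.
  by rewrite divfK ?intr_eq0 ?denq_eq0.
move=> rho1.
have cop : coprimez (denq r) p.
  rewrite coprimez_sym coprimezE /= prime_coprime //; apply/negP => pd.
  have : absp K (numq r)%:~R < 1.
    rewrite -rhoE; apply: le_lt_trans (abspM_le1 rho1 (lexx _)) _.
    exact: absp_int_dvd_lt1.
  rewrite absp_int_coprime ?ltxx // coprimezE /= coprime_sym prime_coprime //.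
  apply/negP => pn; have := coprime_num_den r.
  by rewrite /coprime => /eqP e; have := dvdn_gcd p `|numq r| `|denq r|;
     rewrite e pn pd dvdn1 => /eqP p1; move: p_prime; rewrite p1.
have d1 : absp K d = 1 by exact: absp_int_coprime.
case/coprimezP: cop => -[u v] /= e; exists (numq r * u).
have -> : rho - (numq r * u)%:~R = (rho * v%:~R) * p%:R.
  have ud : 1 - u%:~R * d = v%:~R * p%:R.
    have := congr1 (fun m => m%:~R : K) e; rewrite intrD !intrM => /esym/eqP h.
    by apply/eqP; rewrite subr_eq addrC.
  by rewrite -[RHS]mulrA -ud intrM -rhoE; ring.
apply: le_lt_trans (p_inv_lt1 R p_prime); rewrite -(absp_p K p_prime).
by rewrite abspM_le1 // abspM_le1 ?absp_int_le1.
Qed.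

Definition Qp_to_Cp : {rmorphism Qp K -> K} :=
  (Qpbar_to_Cp K) \o (Qp_to_Qpbar K).

Lemma Qp_residue (x : Qp K) : absp K (Qp_to_Cp x) <= 1 ->
  exists m, absp K (Qp_to_Cp x - m%:~R) < 1.
Proof.
move=> x1.
have [r hr] := compl_dense (Qp_completion K) x ltr01.
have {}hr : absp K (Qp_to_Cp x - rat_to_Cp K r) < 1.
  by rewrite -[rat_to_Cp K r]/(Qp_to_Cp (rat_to_Qp K r)) -rmorphB absp_embed.
have r1 : absp K (rat_to_Cp K r) <= 1.
  by rewrite -[rat_to_Cp K r](subKr (Qp_to_Cp x)) abspB_le // ltW.
have [m hm] := rat_residue r1.
by exists m; apply: absp_trans_lt hr hm.
Qed.

Definition int_horner x (Q : {poly int}) : K := (map_poly intr Q).[x].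

Lemma int_hornerD x Q1 Q2 :
  int_horner x (Q1 + Q2) = int_horner x Q1 + int_horner x Q2.
Proof. by rewrite /int_horner rmorphD hornerD. Qed.

Lemma int_hornerB x Q1 Q2 :
  int_horner x (Q1 - Q2) = int_horner x Q1 - int_horner x Q2.
Proof. by rewrite /int_horner rmorphB hornerD hornerN. Qed.

Lemma int_hornerM x Q1 Q2 :
  int_horner x (Q1 * Q2) = int_horner x Q1 * int_horner x Q2.
Proof. by rewrite /int_horner rmorphM hornerM. Qed.

Lemma int_hornerXn x n : int_horner x 'X^n = x ^+ n.
Proof. by rewrite /int_horner map_polyXn hornerXn. Qed.

Lemma int_horner_coef_wide x (Q : {poly int}) n : (size Q <= n)%N ->
  int_horner x Q = \sum_(i < n) (Q`_i)%:~R * x ^+ i.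
Proof.
move=> sz; rewrite /int_horner (@horner_coef_wide _ n).
  by apply: eq_bigr => i _; rewrite coef_map.
exact: leq_trans (size_poly _ _) sz.
Qed.

Lemma absp_int_horner_le1 x Q : absp K x <= 1 -> absp K (int_horner x Q) <= 1.
Proof.
move=> x1; rewrite (int_horner_coef_wide _ (leqnn _)).
apply: absp_sum_le => // i _.
by rewrite abspM_le1 ?absp_int_le1 ?abspX_le1.
Qed.

(** A polynomial that kills [s] is divided by its last coefficient of maximal absolute value;
    integers close to the new coefficients form [G]. *)
Lemma algebraic_residue (s : Qpbar K) : absp K (Qpbar_to_Cp K s) <= 1 ->
  exists2 G : {poly int}, G \is monic &
    absp K (int_horner (Qpbar_to_Cp K s) G) < 1.
Proof.
set x := Qpbar_to_Cp K s => x1.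
have [P P0 Ps] := Qpbar_algebraic s.
have Px : \sum_(i < (size P).-1.+1) Qp_to_Cp P`_i * x ^+ i = 0.
  have : root (map_poly Qp_to_Cp P) x.
    rewrite -[map_poly _ _]/(map_poly (Qpbar_to_Cp K \o Qp_to_Qpbar K) P).
    by rewrite map_poly_comp fmorph_root.
  move/rootP; rewrite (@horner_coef_wide _ (size P).-1.+1).
    by move=> e; rewrite -[RHS]e; apply: eq_bigr => i _; rewrite coef_map.
  by rewrite size_map_poly leqSpred.
set n := (size P).-1 in Px.
have [D Dn hD] := last_argmax (fun i => absp K (Qp_to_Cp P`_i)) n.
set c := Qp_to_Cp P`_D in hD.
have c_gt0 : 0 < absp K c.
  apply: lt_le_trans (hD n (leqnn _)).1.
  by rewrite absp_gt0 fmorph_eq0 -lead_coefE lead_coef_eq0.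
have c0 : c != 0 by rewrite -absp_gt0.
(* The values at [D] and beyond are exact, which makes [G] monic of degree [D]; 0 is a close enough
   value beyond [D] because [D] is the last maximum. *)
have hcoef i : exists m : int, [/\
    (i <= n)%N -> absp K (m%:~R - Qp_to_Cp P`_i / c) < 1,
    i = D -> m = 1 & (D < i)%N -> m = 0].
  have [iD|Di|->] := ltngtP i D.
  - have : absp K (Qp_to_Cp (P`_i / P`_D)) <= 1.
      rewrite fmorph_div abspM abspV ler_pdivrMr // mul1r.
      by apply: (hD _ _).1; apply: leq_trans (ltnW iD) Dn.
    case/Qp_residue=> m hm; exists m; split=> [_|e|//].
      by rewrite abspBC -fmorph_div.
    by rewrite e ltnn in iD.
  - exists 0; split=> // [i_n|e]; last by rewrite e ltnn in Di.
    rewrite sub0r abspN abspM abspV ltr_pdivrMr // mul1r.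
    exact: (hD _ i_n).2.
  - by exists 1; split; rewrite ?ltnn // => _; rewrite divff // subrr absp0.
have [g hg] := choice hcoef.
pose G := \poly_(i < D.+1) g i.
have gD : g D = 1 by case: (hg D) => _ ->.
have sG : size G = D.+1 by rewrite size_poly_eq //= gD.
have Gi i : G`_i = g i.
  rewrite coef_poly ltnS; case: leqP => // Di.
  by case: (hg i) => _ _ ->.
exists G; first by rewrite monicE lead_coefE sG /= Gi gD.
rewrite (@int_horner_coef_wide _ _ n.+1) ?sG ?ltnS //.
(* Subtracting [c^-1] times the relation [Px] leaves only the small differences of the
   coefficients. *)
have := mulr0 c^-1; rewrite -{1}Px mulr_sumr => Pxc.
rewrite -[X in absp K X]subr0 -[X in _ - X]Pxc -sumrB.
apply: absp_sum_lt => // i _.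
rewrite mulrA -mulrBl mulrC [c^-1 * _]mulrC.
apply: le_lt_trans (abspM_le1 (abspX_le1 i x1) (lexx _)) _.
by rewrite Gi; case: (hg i) => -> //; rewrite -ltnS.
Qed.

(** The powers of [x] have finitely many remainders modulo [p] and [G], so two of them share a
    residue, and the smaller power cancels as it has absolute value 1. *)
Lemma residue_periodic (s : Qpbar K) : absp K (Qpbar_to_Cp K s) = 1 ->
  exists2 d, (0 < d)%N & absp K (Qpbar_to_Cp K s ^+ d - 1) < 1.
Proof.
set x := Qpbar_to_Cp K s => xE; have x1 : absp K x <= 1 by rewrite xE.
have [G Gmon Gx] := algebraic_residue x1.
have p0 : p%:Z != 0 by rewrite eqz_nat -lt0n prime_gt0.
pose rem n := Pdiv.CommonRing.rmodp 'X^n G.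
have rem_size n : (size (rem n) <= size G)%N.
  by rewrite ltnW // Pdiv.Ring.ltn_rmodpN0 ?monic_neq0.
have rem_close n : absp K (x ^+ n - int_horner x (rem n)) < 1.
  rewrite -int_hornerXn {1}(Pdiv.RingMonic.rdivp_eq Gmon 'X^n).
  rewrite int_hornerD addrK int_hornerM.
  by apply: le_lt_trans (abspM_le1 (absp_int_horner_le1 _ x1) (lexx _)) Gx.
pose h n := [ffun i : 'I_(size G) => inord `|((rem n)`_i %% p)%Z|%N : 'I_p.+1].
have [i [j [ij hij]]] := nat_pigeonhole h.
have rem_ij : absp K (int_horner x (rem i) - int_horner x (rem j)) < 1.
  rewrite -int_hornerB (@int_horner_coef_wide _ _ (size G)); last first.
    by rewrite (leq_trans (size_polyD _ _)) // size_polyN geq_max !rem_size.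
  apply: absp_sum_lt => // k _; rewrite mulrC.
  apply: le_lt_trans (abspM_le1 (abspX_le1 k x1) (lexx _)) _.
  apply: absp_int_dvd_lt1; rewrite coefB -eqz_mod_dvd; apply/eqP.
  have lt n : (`|((rem n)`_k %% p)%Z| < p.+1)%N.
    rewrite -ltz_nat gez0_abs ?modz_ge0 //.
    by rewrite (lt_trans (ltz_pmod _ _)) ?ltz_nat ?prime_gt0.
  have /ffunP/(_ k) := hij; rewrite !ffunE => /(congr1 (@nat_of_ord _)).
  rewrite !inordK // => e.
  by rewrite -[LHS]gez0_abs ?modz_ge0 // -[RHS]gez0_abs ?modz_ge0 // e.
exists (j - i)%N; first by rewrite subn_gt0.
have : absp K (x ^+ j - x ^+ i) < 1.
  apply: absp_trans_lt (rem_close j) _; rewrite abspBC.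
  exact: absp_trans_lt (rem_close i) rem_ij.
rewrite -{1}(subnKC (ltnW ij)) exprD -{2}[x ^+ i]mulr1 -mulrBr abspM abspX xE.
by rewrite expr1n mul1r.
Qed.

(** By density [t] is replaced by a nearby [x] coming from [Qpbar], where ['X^d' - 1] splits. *)
Lemma teichmuller_exists (t : K) : absp K t = 1 -> exists w : K,
  (exists2 m : nat, coprime m p & m.-primitive_root w) /\ absp K (t - w) < 1.
Proof.
move=> tE; have [s ts] := compl_dense (Cp_completion K) t ltr01.
set x := Qpbar_to_Cp K s in ts.
have xE : absp K x = 1.
  by rewrite -[x](subKr t) abspD_eq ?abspN // tE.
have [d d0 hd] := residue_periodic xE.
have [d' cop dE] := pfactor_coprime p_prime d0.
have d'0 : (0 < d')%N by move: d0; rewrite dE; case: (d').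
(* The [p]-part of [d] is removed by injectivity of the [p]-th power on residues. *)
have {d0}hd' : absp K (x ^+ d' - 1) < 1.
  move: hd; rewrite dE exprM; elim: (logn p d) => [|e IH].
    by rewrite expn0.
  rewrite expnSr exprM -{1}(expr1n K p) => h; apply: IH.
  apply: absp_sub_pX_lt1 h => //; first by rewrite absp1.
  by rewrite abspB_le ?absp1 // abspX_le1 // abspX_le1 ?xE.
have [rs /esym e] := closed_field_poly_normal ('X^d' - 1 : {poly Qpbar K}).
have mon : 'X^d' - 1 \is @monic (Qpbar K) by apply: monicXnsubC.
rewrite (monicP mon) scale1r in e.
have /hasP[w wrs hw] : has (fun w => absp K (x - Qpbar_to_Cp K w) < 1) rs.
  apply: contraLR hd' => /hasPn hrs; rewrite -leNgt.
  have -> : x ^+ d' - 1 = Qpbar_to_Cp K ('X^d' - 1).[s].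
    by rewrite hornerD hornerN hornerXn hornerC rmorphB rmorphXn rmorph1.
  rewrite -e horner_prod rmorph_prod big_seq.
  elim/big_ind: _ => [|y1 y2 h1 h2|w /hrs]; first by rewrite absp1.
    by rewrite abspM; apply: le_trans h1 _; rewrite ler_peMr ?absp_ge0.
  by rewrite -leNgt hornerXsubC rmorphB.
have wd : w ^+ d' = 1.
  apply/eqP; rewrite -unity_rootE /root_of_unity -e root_prod_XsubC //.
have [m mw md] := prim_order_exists d'0 wd.
exists (Qpbar_to_Cp K w); split; last exact: absp_trans_lt ts hw.
exists m; last by rewrite fmorph_primitive_root.
by rewrite (coprime_dvdl md) // coprime_sym.
Qed.

End Residues.

(** * The integral of a Laurent series *)

Section Integral.
Variables (R : realType) (p : nat) (K : Cp_field R p).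
Hypothesis p_prime : prime p.

(** If [absp K t < 1] the character is 0 and [l = 1] will do. Otherwise its value has order [m]
    prime to [p], and [l = totient m] works by Euler's theorem. *)
Lemma teichmullerP (t : K) : absp K t <= 1 ->
  absp K (t - teichmuller t) < 1 /\
  exists2 l, (0 < l)%N & teichmuller t ^+ (p ^ l) = teichmuller t.
Proof.
rewrite le_eqVlt /teichmuller; case: eqP => /= [t1 _|_ t1]; last first.
  rewrite subr0; split=> //; exists 1%N => //.
  by rewrite expr0n expn1 gtn_eqF ?prime_gt0.
have [[m mp mw] tw] := xgetPex 0 (teichmuller_exists p_prime t1).
split=> //; have m0 := prim_order_gt0 mw.
exists (totient m); first by rewrite totient_gt0.
rewrite -(prim_expr_mod mw) Euler_exp_totient 1?coprime_sym //.
by rewrite (prim_expr_mod mw) expr1.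
Qed.

Lemma expr_pX_fixed (w : K) l n k : w ^+ (p ^ l) = w ->
  w ^+ (p ^ (n + l * k)) = w ^+ (p ^ n).
Proof.
move=> wl; rewrite addnC expnD exprM; congr (_ ^+ _).
elim: k => [|k IH]; first by rewrite muln0.
by rewrite mulnS expnD exprM wl.
Qed.

Lemma geometric_small (C e : R) : 0 < e ->
  exists N, forall n, (N <= n)%N -> C * p%:R^-1 ^+ n < e.
Proof.
move=> e0; have rho : `|p%:R^-1 : R| < 1.
  by rewrite ger0_norm ?invr_ge0 // p_inv_lt1.
have /cvgrPdist_lt/(_ e e0)[N _ hN] := cvg_geometric C rho.
exists N => n /hN /=; rewrite sub0r normrN; apply: le_lt_trans.
exact: ler_norm.
Qed.

Lemma abs_cvg_lt (u : nat -> K) l e : abs_cvg (absp K) u l -> 0 < e ->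
  exists N, forall n, (N <= n)%N -> absp K (u n - l) < e.
Proof.
move=> h e0; have /cvgrPdist_lt/(_ e e0)[N _ hN] := h.
by exists N => n /hN /=; rewrite sub0r normrN ger0_norm ?absp_ge0.
Qed.

Lemma abs_cvg_term (u : nat -> K) s e :
  abs_cvg (absp K) (fun N => \sum_(0 <= n < N) u n) s -> 0 < e ->
  exists N, forall n, (N <= n)%N -> absp K (u n) < e.
Proof.
move=> h e0; have [N hN] := abs_cvg_lt h e0; exists N => n Nn.
have hn := hN n Nn; rewrite abspBC in hn.
have := absp_trans_lt (hN n.+1 (leqW Nn)) hn.
by rewrite big_nat_recr //= [X in X - _]addrC addrK.
Qed.

Variables (x0 : K) (r : R) (f : K -> K) (c : int -> K) (a b : K).
Hypotheses (r_gt0 : 0 < r) (abs_ab : absp K (a - b) = r)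
  (b_circle : circle x0 r b)
  (laurent : forall x : K, circle x0 r x -> laurent_sum c (x - x0) (f x)).

Let t := (a - x0) / (a - b).

Let ab_neq0 : a - b != 0.
Proof. by rewrite -absp_gt0 abs_ab. Qed.

Let abs_ba : absp K (b - a) = r.
Proof. by rewrite abspBC. Qed.

Let ba_neq0 : b - a != 0.
Proof. by rewrite -absp_gt0 abs_ba. Qed.

Let abs_t : absp K t <= 1.
Proof.
rewrite abspM abspV abs_ab ler_pdivrMr // mul1r -(subrKA b) abspD_le ?abs_ab //.
by rewrite (eqP (_ : absp K (b - x0) == r)) //; apply/eqP.
Qed.

(** Here [1 - t = (x0 - b) / (a - b)], a quotient of two elements of absolute value [r]. *)
Let abs_1t : absp K (1 - t) = 1.
Proof.
rewrite -(divff ab_neq0) -mulrBl opprB addrC addrA subrK abspM abspV abs_ab.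
by rewrite abspBC b_circle divff // gt_eqF.
Qed.

Lemma node_sub_center z : a + (b - a) * z - x0 = (b - a) * (z - t).
Proof.
have -> : (b - a) * (z - t) = (b - a) * z + (a - b) * t by ring.
by rewrite /t mulrCA divff // mulr1 addrAC addrC addrA.
Qed.

(** Coefficients of [z * (z - t) ^+ m] and [z / (z - t) ^+ m.+1] in [(x - a) * f x] at the node
    given by [z]; [h 0] is the residue. *)
Let g m := c m%:Z * (b - a) ^+ m.+1.
Let h m := c (- m.+1%:Z) / (b - a) ^+ m.

(** As [b - a] and [b - x0] both have absolute value [r], convergence at the single point [b]
    controls the coefficients. *)
Lemma abs_taylor_coef m : absp K (g m) = r * absp K (c m%:Z * (b - x0) ^ m%:Z).
Proof. by rewrite /g !abspM !abspX abs_ba b_circle exprS mulrCA. Qed.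

Lemma abs_polar_coef m :
  absp K (h m) = r * absp K (c (- m.+1%:Z) * (b - x0) ^ (- m.+1%:Z)).
Proof.
rewrite /h -exprnN !abspM !abspV !abspX abs_ba b_circle exprS invfM mulrCA.
by rewrite [r * (_ * _)]mulrA divff ?gt_eqF // mul1r.
Qed.

Lemma taylor_coef_small e : 0 < e ->
  exists N, forall m, (N <= m)%N -> absp K (g m) < e.
Proof.
move=> e0; have [s1 [s2 [h1 _ _]]] := laurent b_circle.
have [N hN] := abs_cvg_term h1 (divr_gt0 e0 r_gt0); exists N => m /hN.
by rewrite abs_taylor_coef ltr_pdivlMr // mulrC.
Qed.

Lemma polar_coef_small e : 0 < e ->
  exists N, forall m, (N <= m)%N -> absp K (h m) < e.
Proof.
move=> e0; have [s1 [s2 [_ h2 _]]] := laurent b_circle.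
have [N hN] := abs_cvg_term h2 (divr_gt0 e0 r_gt0); exists N => m /hN.
by rewrite abs_polar_coef ltr_pdivlMr // mulrC.
Qed.

Section Level.
Variables (n : nat) (z : K).
Hypothesis zP : (p ^ n).-primitive_root z.
Local Notation q := (p ^ n)%N.

(** At a fixed level the nodes are finitely many, so one truncation of the series serves them
    all. *)
Lemma average_close e : 0 < e -> exists N0, forall N, (N0 <= N)%N ->
  absp K (root_mean q z (fun x => (b - a) * x * f (a + (b - a) * x)) -
    (\sum_(m < N) g m * shift_mean q z t m +
     \sum_(m < N) h m * pole_mean q z t m)) < e.
Proof.
move=> e0.
have q0 : q%:R != 0 :> K by rewrite natrK_eq0 -lt0n expn_gt0 prime_gt0.
have absq0 : 0 < absp K q%:R by rewrite absp_gt0.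
pose y i := (b - a) * (z ^+ i - t).
have abs_y i : absp K (y i) = r.
  by rewrite abspM (absp_node_sub p_prime zP abs_1t) mulr1.
have y0 i : y i != 0 by rewrite -absp_gt0 abs_y.
(* This makes up for the division by [q] and for the weight [(b - a) * x], of absolute value [r]. *)
pose d := e * absp K q%:R / r.
have d0 : 0 < d by rewrite divr_gt0 ?mulr_gt0.
pose part i N := \sum_(m < N) c m%:Z * y i ^+ m +
  \sum_(m < N) c (- m.+1%:Z) / y i ^+ m.+1.
have hN i : exists N0, forall N, (N0 <= N)%N ->
    absp K (f (a + (b - a) * z ^+ i) - part i N) < d.
  have xc : circle x0 r (a + (b - a) * z ^+ i).
    by rewrite /circle /= node_sub_center abs_y.
  have [s1 [s2 [h1 h2 ->]]] := laurent xc.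
  rewrite node_sub_center in h1 h2.
  have [N1 hN1] := abs_cvg_lt h1 d0; have [N2 hN2] := abs_cvg_lt h2 d0.
  exists (maxn N1 N2) => N; rewrite geq_max => /andP[/hN1 l1 /hN2 l2].
  rewrite abspBC big_mkord in l1; rewrite abspBC big_mkord in l2.
  rewrite /part opprD addrACA abspD_lt //.
have [N0 hN0] := choice hN.
exists (\max_(i < q) N0 i)%N => N /bigmax_leqP hq.
have -> : \sum_(m < N) g m * shift_mean q z t m +
    \sum_(m < N) h m * pole_mean q z t m =
    root_mean q z (fun x => \sum_(m < N) g m * (x * (x - t) ^+ m) +
      \sum_(m < N) h m * (x / (x - t) ^+ m.+1)).
  rewrite root_meanD.
  rewrite (root_mean_sum q z N (fun m x => g m * (x * (x - t) ^+ m))).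
  rewrite (root_mean_sum q z N (fun m x => h m * (x / (x - t) ^+ m.+1))).
  by congr (_ + _); apply: eq_bigr => m _; rewrite root_meanZ.
have partE i : \sum_(m < N) g m * (z ^+ i * (z ^+ i - t) ^+ m) +
    \sum_(m < N) h m * (z ^+ i / (z ^+ i - t) ^+ m.+1) =
    (b - a) * z ^+ i * part i N.
  have zt0 : z ^+ i - t != 0.
    by have := y0 i; rewrite /y mulf_eq0 negb_or => /andP[].
  rewrite mulrDr !mulr_sumr; congr (_ + _); apply: eq_bigr => m _.
    by rewrite /g /y exprMn exprS; ring.
  by rewrite /h /y exprMn !exprS; field; rewrite !expf_neq0 // ba_neq0 zt0.
rewrite /root_mean -mulrBr -sumrB abspM abspV mulrC ltr_pdivrMr //.
apply: absp_sum_lt => [|i _]; first by rewrite mulr_gt0.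
rewrite partE -mulrBr !abspM abs_ba.
have -> : absp K (z ^+ i) = 1.
  apply: (@absp_expr1 _ _ _ _ q); first exact: prim_order_gt0 zP.
  by rewrite exprAC (prim_expr_order zP) expr1n absp1.
by rewrite mulr1 mulrC -ltr_pdivlMr // hN0 // hq.
Qed.

End Level.

(** * Passage to the limit along a path *)

Lemma laurent_integral (alpha : nat) :
  has_integral f a b (Phi_ alpha%:Z)
    (c (- 1%:Z) / (1 - teichmuller t ^+ (p ^ alpha))).
Proof.
move=> e e0; set w := teichmuller t; set W := w ^+ (p ^ alpha).
have [tw [l l0 wl]] := teichmullerP abs_t.
have w1 : absp K w <= 1 by rewrite -[w](subKr t) abspB_le // ltW.
(* With step [l], the power [w ^+ (p ^ phi k)] does not depend on [k]. *)
have [phi [phi_start phi_path]] := arith_path_exists alpha%:Z l0.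
have phiE k : phi k = (alpha + l * k)%N.
  by rewrite phi_path /arith_fun -PoszD absz_nat.
exists phi.
  by exists l => // k _; rewrite phiE PoszD.
have [M1 hM1] := taylor_coef_small e0.
have [M2 hM2] := polar_coef_small e0.
have hM m : exists N, forall n, (N <= n)%N ->
    absp K (h m) / absp K m`!%:R * p%:R^-1 ^+ n < e by exact: geometric_small.
have [Nf hNf] := choice hM.
(* The bound 1 forces [1 - W] to have absolute value 1; the 1 in the denominator covers a zero
   residue. *)
pose d := Num.min 1 (e / (absp K (c (- 1%:Z)) + 1)).
have c1_gt0 : 0 < absp K (c (- 1%:Z)) + 1 by rewrite ltr_wpDl ?absp_ge0.
have d0 : 0 < d by rewrite lt_min ltr01 divr_gt0.
have [N3 hN3] := absp_sub_exp_cvg p_prime w1 tw d0.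
exists (\max_(m < M2) Nf m + M1 + N3)%N => k _ kN.
set n := phi k.
have kn : (k <= n)%N.
  by rewrite /n phiE (leq_trans (leq_pmull k l0)) // leq_addl.
have nNf (m : 'I_M2) : (Nf m <= n)%N.
  apply: leq_trans (@leq_bigmax 'I_M2 (fun i => Nf i) m) _.
  by rewrite (leq_trans _ kn) // (leq_trans _ (ltnW kN)) // -addnA leq_addr.
(* The shifted means that do not vanish then have index [m > M1], where [g m] is small. *)
have nM1 : (M1.+1 < p ^ n)%N.
  by apply: leq_ltn_trans (ltn_expl n (prime_gt1 p_prime)); lia.
have nN3 : (N3 <= n)%N by lia.
have [z zP] := Cp_prim_root_exists K (leq_trans (ltn0Sn _) (ltnW nM1)).
have -> : path_average f a b phi k =
    root_mean (p ^ n) z (fun x => (b - a) * x * f (a + (b - a) * x)).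
  rewrite /path_average (sum_unity_root _ zP) -natrX.
  congr (_ * _); apply: eq_bigr => i _.
  by rewrite [a + _]addrC addrK.
have [N0 hN0] := average_close zP e0.
(* The truncation [N0.+1] is positive, so the polar sum contains the residue term. *)
apply: absp_trans_lt (hN0 N0.+1 (leqnSn _)) _.
rewrite -addrA abspD_lt //.
  apply: absp_sum_lt => // m _; rewrite mulrC.
  have [mq|qm] := ltnP m.+1 (p ^ n).
    rewrite shift_mean_small ?mul0r ?absp0 //.
    by rewrite natrK_eq0 -lt0n expn_gt0 prime_gt0.
  apply: le_lt_trans (abspM_le1 (shift_mean_le1 p_prime zP abs_t m) (lexx _)) _.
  by apply: hM1; lia.
(* The residue term is set apart. Below [M2] the means are small, and from [M2] on the coefficients
   are. *)
rewrite big_ord_recl /= addrAC abspD_lt //; last first.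
  apply: absp_sum_lt => // i _; rewrite /bump add1n; set m := i.+1.
  have [mM|Mm] := ltnP m M2.
    apply: le_lt_trans (hNf m n (nNf (Ordinal mM))).
    rewrite abspM mulrAC -mulrA ler_wpM2l ?absp_ge0 //.
    exact: (pole_mean_le p_prime zP abs_t abs_1t).
  rewrite mulrC.
  have S1 := pole_mean_le1 p_prime zP abs_t abs_1t m.
  by apply: le_lt_trans (abspM_le1 S1 (lexx _)) _; apply: hM2.
have wn : w ^+ (p ^ n) = W by rewrite /n phiE (expr_pX_fixed alpha k wl).
have := hN3 n nN3; rewrite wn => tW.
have u1 : absp K (1 - t ^+ (p ^ n)) = 1 := absp_1_sub_exp p_prime zP abs_1t.
have W1 : absp K (1 - W) = 1.
  rewrite -(subrKA (t ^+ (p ^ n))) abspD_eq // u1.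
  by apply: lt_le_trans tW _; rewrite ge_min lexx.
have u0 : 1 - t ^+ (p ^ n) != 0 by rewrite -absp_gt0 u1.
have W0 : 1 - W != 0 by rewrite -absp_gt0 W1.
rewrite (pole_mean0 p_prime zP abs_1t) /h expr0 invr1 mulr1.
(* Both denominators have absolute value 1, so the error is that of [t ^+ (p ^ n) - W] times
   [absp K (c (- 1%:Z))]. *)
have -> : c (- 1%:Z) / (1 - t ^+ (p ^ n)) - c (- 1%:Z) / (1 - W) =
    c (- 1%:Z) * (t ^+ (p ^ n) - W) / ((1 - t ^+ (p ^ n)) * (1 - W)).
  by field; rewrite u0 W0.
rewrite !abspM abspV abspM u1 W1 mulr1 invr1 mulr1.
have tW' : absp K (t ^+ (p ^ n) - W) < e / (absp K (c (- 1%:Z)) + 1).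
  by apply: lt_le_trans tW _; rewrite ge_min lexx orbT.
rewrite ltr_pdivlMr // mulrC in tW'; apply: le_lt_trans tW'.
by rewrite ler_wpM2r ?absp_ge0 // lerDl.
Qed.

End Integral.

Unset Implicit Arguments.

Theorem theorem6p1 (R : realType) (p : nat) (hp : prime p) (hodd : odd p)
    (K : Cp_field R p)
    (x0 : K) (r : R) (hr : 0 < r)
    (f : K -> K) (c : int -> K)
    (hf : forall x : K, circle x0 r x -> laurent_sum c (x - x0) (f x))
    (b : K) (hb : circle x0 r b)
    (a : K) (hab : absp K (a - b) = r)
    (alpha : nat) :
  has_integral f a b (Phi_ alpha%:Z)
    (c (- 1%:Z) / (1 - teichmuller ((a - x0) / (a - b)) ^+ (p ^ alpha))).
Proof. exact: laurent_integral hr hab hb hf alpha. Qed.
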